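(* Let $n\in\mathbb N$, let $\pi$ be the discrete uniform distribution on $\mathcal X=\{1,\dots,n\}$, and let $G=\{e,g,g^2,\dots,g^{n-1}\}$ be the group generated by the cyclic shift $gx=x+1$ for $1\le x\le n-1$, $gn=1$. For every $\pi$-stationary Markov kernel $P$ on $\mathcal X$ (i.e. $\pi P=\pi$), $$P_{la}=\Pi.$$ Consequently $P_{ra}=(P_{la})_{ra}=\Pi$, and hence, for any $\varepsilon>0$ and $1\le p\le\infty$, $$t_{\mathrm{mix},p}(P_{la},\varepsilon)=t_{\mathrm{mix},p}(P_{ra},\varepsilon)=t_{\mathrm{mix},p}((P_{la})_{ra},\varepsilon)=1.$$
   Context: $\mu$ is the uniform distribution on $G$; $U_g[f](x)=f(gx)$; $P_{la}=\mathbb E_{g\sim\mu}(U_gP)$, $P_{ra}=\mathbb E_{g\sim\mu}(PU_g)$, $(P_{la})_{ra}=\mathbb E_{(g,h)\sim\mu\otimes\mu}(U_gPU_h)$. $\Pi$ is the kernel with $\Pi(x,y)=\pi(y)$ for all $x,y$. For $t\in\mathbb N=\{1,2,\dots\}$ and $1\le p\le\infty$, $d_p(P,t)=\max_{x\in\mathcal X}\big\|\frac{P^t(x,\cdot)}{\pi(\cdot)}-1\big\|_{L^p(\pi)}$ and $t_{\mathrm{mix},p}(P,\varepsilon)=\inf\{t\in\mathbb N:d_p(P,t)\le\varepsilon\}$. *)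

(* Defs.v *)
From HB Require Import structures.
From mathcomp Require Import all_boot all_order all_fingroup all_algebra.
From mathcomp Require Import all_classical all_reals all_analysis.

Set Implicit Arguments.
Unset Strict Implicit.
Unset Printing Implicit Defensive.
Import Order.TTheory GRing.Theory Num.Theory.

Local Open Scope classical_set_scope.
Local Open Scope ring_scope.

(* The state space is 'I_n.+1: there are n.+1 states (so at least one, as
   measurable types are nonempty), and the state x of {1, ..., n.+1} is encoded
   as x - 1. Every subset is measurable. *)
HB.instance Definition _ (n : nat) := isPointed.Build 'I_n.+1 ord0.
HB.instance Definition _ (n : nat) := @isMeasurable.Build
  default_measure_display 'I_n.+1 discrete_measurable discrete_measurable0
  discrete_measurableC discrete_measurableU.

Section distributions.
Context {R : realType} {n : nat}.

Definition unif_dist : {measure set 'I_n.+1 -> \bar R} :=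
  mscale ((n.+1%:R : R)^-1)%:nng (@counting 'I_n.+1 R).

Definition mass (pi : {measure set 'I_n.+1 -> \bar R}) (y : 'I_n.+1) : R :=
  fine (pi [set y]).

Lemma mass_unif_dist (y : 'I_n.+1) : mass unif_dist y = n.+1%:R^-1.
Proof.
rewrite /mass /unif_dist /= /mscale /= /counting asboolT//=.
by rewrite fset_set1 finmap.cardfs1 /= mulr1.
Qed.

(* 'M[R]_n.+1 is the space of kernels on 'I_n.+1; a kernel P acts on a function f,
   seen as a column vector, by P *m f. *)
Definition markov_kernel (P : 'M[R]_n.+1) : Prop :=
  (forall x y, 0 <= P x y) /\ (forall x, \sum_y P x y = 1).

Definition stationary (pi : {measure set 'I_n.+1 -> \bar R}) (P : 'M[R]_n.+1) : Prop :=
  forall y, \sum_x mass pi x * P x y = mass pi y.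

Definition Pi_kernel (pi : {measure set 'I_n.+1 -> \bar R}) : 'M[R]_n.+1 :=
  \matrix_(x, y) mass pi y.

Definition U (g : 'S_n.+1) : 'M[R]_n.+1 := perm_mx g.

Lemma UE (g : 'S_n.+1) (f : 'cV[R]_n.+1) x : (U g *m f) x ord0 = f (g x) ord0.
Proof. by rewrite /U -row_permE mxE. Qed.

(* Distributions on a finite type given by their mass function. *)
Definition unif_on (T : finType) (A : {set T}) (t : T) : R :=
  (t \in A)%:R / #|A|%:R.

Definition prod_dist (T : finType) (mu nu : T -> R) (u : T * T) : R :=
  mu u.1 * nu u.2.

Definition expect (T : finType) (mu : T -> R) (F : T -> 'M[R]_n.+1) : 'M[R]_n.+1 :=
  \sum_t mu t *: F t.

Definition left_avg (G : {set 'S_n.+1}) (P : 'M[R]_n.+1) : 'M[R]_n.+1 :=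
  expect (unif_on G) (fun g => U g *m P).

Definition right_avg (G : {set 'S_n.+1}) (P : 'M[R]_n.+1) : 'M[R]_n.+1 :=
  expect (unif_on G) (fun g => P *m U g).

Definition left_right_avg (G : {set 'S_n.+1}) (P : 'M[R]_n.+1) : 'M[R]_n.+1 :=
  expect (prod_dist (unif_on G) (unif_on G)) (fun u => U u.1 *m P *m U u.2).

Lemma left_right_avgE (G : {set 'S_n.+1}) (P : 'M[R]_n.+1) :
  left_right_avg G P = right_avg G (left_avg G P).
Proof.
rewrite /left_right_avg /right_avg /left_avg /expect /prod_dist.
under [RHS]eq_bigr do rewrite mulmx_suml scaler_sumr.
rewrite [RHS]exchange_big pair_bigA/=; apply: eq_bigr => u _.
by rewrite -scalemxAl scalerA mulrC.
Qed.

Definition dist_p (pi : {measure set 'I_n.+1 -> \bar R}) (p : \bar R)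
    (P : 'M[R]_n.+1) (t : nat) : \bar R :=
  \big[maxe/-oo%E]_(x : 'I_n.+1)
    Lnorm pi p (fun y => ((P ^+ t) x y / mass pi y - 1)%:E).

(* Times are positive integers; the infimum of the empty set is +oo. *)
Definition tmix (pi : {measure set 'I_n.+1 -> \bar R}) (p : \bar R)
    (P : 'M[R]_n.+1) (eps : R) : \bar R :=
  ereal_inf [set t%:R%:E | t in
    [set t : nat | (0 < t)%N /\ (dist_p pi p P t <= eps%:E)%E]].

End distributions.
Arguments unif_dist : clear implicits.

Definition cshift (n : nat) : 'S_n.+1 := perm (@ordS_inj n.+1).

Lemma cshift_cycleE (n : nat) :
  <[cshift n]>%g = [set (cshift n ^+ i)%g | i : 'I_n.+1]%SET.
Proof.
have cX k x : (cshift n ^+ k)%g x = ((x + k) %% n.+1)%N :> nat.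
  elim: k => [|k IH]; first by rewrite expg0 perm1 addn0 modn_small.
  by rewrite expgSr permM permE /= IH -[((_ %% _).+1)%N]addn1 modnDml addn1 addnS.
have cn : (cshift n ^+ n.+1 = 1)%g.
  by apply/permP => x; apply: ord_inj; rewrite cX perm1 modnDr modn_small.
apply/setP => s; apply/idP/imsetP => [/cycleP[k ->]|[i _ ->]]; last exact: mem_cycle.
exists (Ordinal (ltn_pmod k (ltn0Sn n))) => //=.
by rewrite [in LHS](divn_eq k n.+1) expgD mulnC expgM cn expg1n mul1g.
Qed.

(* Main.v *)
Require Import Defs.
From HB Require Import structures.
From mathcomp Require Import all_boot all_order all_fingroup all_algebra.
From mathcomp Require Import all_classical all_reals all_analysis.
Import Order.TTheory GRing.Theory Num.Theory.
Local Open Scope ring_scope.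

(** The group generated by the cyclic shift acts transitively on the states, and
    averaging the operators [U g] over a transitive group [G] gives exactly the
    kernel [Pi] of the uniform distribution ([expect_U_transitive]).

    Averaging is linear, so [left_avg G P] is [Pi *m P] and [right_avg G P] is
    [P *m Pi].  The first product is [Pi] because the uniform distribution is
    stationary for [P], the second because the rows of [P] sum to 1.  The rows
    of [Pi] sum to 1 too, so the right average of [left_avg G P = Pi] is again
    [Pi].

    All three averages being [Pi], their mixing times agree; they equal 1
    because [Pi] is at distance 0 from equilibrium after one step, and 1 is the
    smallest time allowed ([tmix_Pi_kernel]). *)

Lemma cshift_transitive (n : nat) :
  [transitive <[cshift n]>%g, on [set: 'I_n.+1] | 'P].
Proof.
have iter_cshift k : (k <= n)%N -> (cshift n ^+ k)%g ord0 = k :> nat.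
  elim: k => [|k IH] k_le; first by rewrite expg0 perm1.
  by rewrite expgSr permM permE /= (IH (ltnW k_le)) modn_small.
apply/imsetP; exists ord0; rewrite ?inE//; apply/setP => y; rewrite inE.
apply/esym/orbitP; exists (cshift n ^+ y)%g; first exact: mem_cycle.
by apply: ord_inj; rewrite /= apermE iter_cshift// -ltnS.
Qed.

Lemma sum_unif_on (R : realType) (T : finType) (A : {set T}) :
  (0 < #|A|)%N -> \sum_t unif_on A t = 1 :> R.
Proof.
move=> A_gt0; rewrite /unif_on -mulr_suml -natr_sum -big_mkcond sum1_card.
by rewrite divff// pnatr_eq0 -lt0n.
Qed.

(** The averaged matrix [A] satisfies [A *m U h = A] for [h] in [G], because right
    translation by [h] permutes [G].  Hence each row of [A] is invariant under a
    transitive action, so it is constant; as it sums to 1, its entries are all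
    the inverse of the number of states. *)
Lemma expect_U_transitive (R : realType) (n : nat) (G : {group 'S_n.+1}) :
  [transitive G, on [set: 'I_n.+1] | 'P] ->
  expect (unif_on G) U = Pi_kernel (unif_dist R n).
Proof.
move=> Gtr; set A := expect _ _.
have AE x y : A x y = \sum_g unif_on G g * (g x == y)%:R.
  by rewrite summxE; apply: eq_bigr => g _; rewrite !mxE.
have A_inv h x y : h \in G -> A x (h y) = A x y.
  move=> Gh; rewrite !AE (reindex_inj (mulIg h)); apply: eq_bigr => g _.
  by rewrite permM (inj_eq perm_inj) /unif_on groupMr.
have A_sum x : \sum_y A x y = 1.
  under eq_bigr do rewrite AE.
  rewrite exchange_big -[RHS](@sum_unif_on R _ G) ?cardG_gt0//.
  apply: eq_bigr => g _; rewrite -mulr_sumr (bigD1 (g x))//= eqxx.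
  by rewrite big1 ?addr0 ?mulr1// => y; rewrite eq_sym => /negPf->.
have A_const x y z : A x z = A x y.
  by have [h Gh ->] := atransP2 Gtr (finset.in_setT y) (finset.in_setT z); exact: A_inv.
apply/matrixP => x y; rewrite mxE mass_unif_dist.
apply: (mulIf (lt0r_neq0 (ltr0Sn R n))).
rewrite mulVf ?pnatr_eq0// -[RHS](A_sum x); under eq_bigr do rewrite (A_const x y).
by rewrite sumr_const card_ord mulr_natr.
Qed.

Lemma left_avgE (R : realType) (n : nat) (G : {set 'S_n.+1}) (P : 'M[R]_n.+1) :
  left_avg G P = expect (unif_on G) U *m P.
Proof.
by rewrite mulmx_suml; apply: eq_bigr => g _; rewrite scalemxAl.
Qed.

Lemma right_avgE (R : realType) (n : nat) (G : {set 'S_n.+1}) (P : 'M[R]_n.+1) :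
  right_avg G P = P *m expect (unif_on G) U.
Proof.
by rewrite mulmx_sumr; apply: eq_bigr => g _; rewrite scalemxAr.
Qed.

(** Each row of [Pi] is the row vector [pi], so that this is the equation
    [pi P = pi] read row by row. *)
Lemma Pi_kernel_mull (R : realType) (n : nat) pi (P : 'M[R]_n.+1) :
  stationary pi P -> Pi_kernel pi *m P = Pi_kernel pi.
Proof.
move=> piP; apply/matrixP => x y; rewrite !mxE -[RHS]piP.
by apply: eq_bigr => z _; rewrite mxE.
Qed.

Lemma Pi_kernel_mulr (R : realType) (n : nat) pi (P : 'M[R]_n.+1) :
  (forall x, \sum_y P x y = 1) -> P *m Pi_kernel pi = Pi_kernel pi.
Proof.
move=> P1; apply/matrixP => x y; rewrite !mxE.
by under eq_bigr do rewrite mxE; rewrite -mulr_suml P1 mul1r.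
Qed.

Lemma Pi_kernel_unif_sum (R : realType) (n : nat) (x : 'I_n.+1) :
  \sum_y Pi_kernel (unif_dist R n) x y = 1.
Proof.
under eq_bigr do rewrite mxE mass_unif_dist.
by rewrite sumr_const card_ord -[LHS]mulr_natr mulVf// pnatr_eq0.
Qed.

(** The density of [Pi] with respect to [pi] is identically 1, so every [L^p]
    distance vanishes at time 1.  Nonzero masses make the density 1 at every
    point, a quotient by a zero mass being 0; for [p = 0] the [L^p] norm of the
    zero function would be 1. *)
Lemma tmix_Pi_kernel (R : realType) (n : nat)
    (pi : {measure set 'I_n.+1 -> \bar R}) (p : \bar R) (eps : R) :
  (forall y, mass pi y != 0) -> p != 0%E -> 0 <= eps ->
  tmix pi p (Pi_kernel pi) eps = 1%E.
Proof.
move=> pi_neq0 p_neq0 eps_ge0; apply/eqP; rewrite eq_le; apply/andP; split.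
  apply: ge_ereal_inf; exists 1%E => //; exists 1%N => //; split=> //.
  apply: bigmax_le => [|x _]; first exact: leNye.
  rewrite [X in Lnorm pi p X](_ : _ = cst 0%E) ?Lnorm0//.
  by apply/funext => y /=; rewrite expr1 mxE divff// subrr.
by apply: le_ereal_inf_tmp => _ [t [t_gt0 _] <-]; rewrite lee_fin ler1n.
Qed.

Theorem proposition7p1 (R : realType) (n : nat)
    (P : 'M[R]_n.+1) (P_markov : markov_kernel P)
    (P_stat : stationary (unif_dist R n) P) :
  let pi := unif_dist R n in
  let G := <[cshift n]>%g in
  [/\ left_avg G P = Pi_kernel pi,
      right_avg G P = left_right_avg G P /\
        left_right_avg G P = Pi_kernel pi
    & forall (eps : R) (p : \bar R), 0 < eps -> (1 <= p)%E ->
        [/\ tmix pi p (left_avg G P) eps = tmix pi p (right_avg G P) eps,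
            tmix pi p (right_avg G P) eps
              = tmix pi p (left_right_avg G P) eps
          & tmix pi p (left_right_avg G P) eps = 1%E]].
Proof.
move=> pi G.
have avgU : expect (unif_on G) U = Pi_kernel pi.
  exact: expect_U_transitive (cshift_transitive n).
have lE : left_avg G P = Pi_kernel pi by rewrite left_avgE avgU Pi_kernel_mull.
have rE : right_avg G P = Pi_kernel pi.
  by rewrite right_avgE avgU Pi_kernel_mulr//; case: P_markov.
have lrE : left_right_avg G P = Pi_kernel pi.
  rewrite left_right_avgE lE right_avgE avgU Pi_kernel_mulr//.
  exact: Pi_kernel_unif_sum.
split=> [//||eps p eps_gt0 p_ge1]; first by rewrite rE lrE.
rewrite lE rE lrE; split=> //; apply: tmix_Pi_kernel.
- by move=> y; rewrite mass_unif_dist invr_eq0 pnatr_eq0.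
- by rewrite gt_eqF// (lt_le_trans _ p_ge1).
- exact: ltW.
Qed.
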